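(* Consider a system $(\Sigma)$ as in the context (in particular satisfying (Lip) and (Mon)) with $n\le l+p$, set $k=l+p-n$, and use the matrices and subspaces defined in the context. Let $\delta>0$, $\mathcal{P}\in\mathbb{R}^{(l+p)\times(n+k)}$ invertible, $\mathcal{K}\in\mathbb{R}^{(n+k)\times(n+k)}$, let $L_1\in\mathbb{R}^{l\times k}$, $L_2\in\mathbb{R}^{p\times k}$ be such that $\begin{bmatrix}0&L_1\\0&L_2\end{bmatrix}=\mathcal{P}^{-\top}\mathcal{K}H$, and form $\mathcal{A}$ from these $L_1,L_2$. Let $V\in\mathbb{R}^{(n+k)\times n_{\mathcal{V}}}$ and $W\in\mathbb{R}^{(n+k)\times n_{\mathcal{W}}}$ be basis matrices of the Wong limits $\mathcal{V}^*_{[\mathcal{E},\mathcal{A}]}$ and $\mathcal{W}^*_{[\mathcal{E},\mathcal{A}]}$, where $n_{\mathcal{V}},n_{\mathcal{W}}$ are their dimensions. Suppose that $$\mathcal{Q}:=\begin{bmatrix}\hat A^\top\mathcal{P}+\mathcal{P}^\top\hat A+H^\top\mathcal{K}^\top+\mathcal{K}H+\delta\mathcal{F}^\top\mathcal{F}-\mu\mathcal{J} & \mathcal{P}^\top\mathcal{B}+\hat\Theta\\ \mathcal{B}^\top\mathcal{P}+\hat\Theta^\top & -\delta\Lambda_{q_L}\end{bmatrix}<_{\mathcal{V}^*_{[[\mathcal{E},0],[\mathcal{A},\mathcal{B}]]}}0$$ and that the following hold: a) $\mathcal{E}^\top\mathcal{P}=\mathcal{P}^\top\mathcal{E}\ge_{\overline{\mathcal{V}}^*_{[[\mathcal{E},0],[\mathcal{A},\mathcal{B}]]}}0$;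 b) the pencil $s\mathcal{E}-\mathcal{A}\in\mathbb{R}[s]^{(l+p)\times(n+k)}$ is regular and its index is at most one; c) $\|FG_L\|<1$, where $G_L:=-[I_n,0]\,W\,[0,I_{n+k-r}]\,[\mathcal{E}V,\mathcal{A}W]^{-1}\begin{bmatrix}B_L\\0\end{bmatrix}$; d) $JG_M$ is invertible and $\mu>\lambda_{\max}(\Gamma)$, where $G_M:=-[I_n,0]\,W\,[0,I_{n+k-r}]\,[\mathcal{E}V,\mathcal{A}W]^{-1}\begin{bmatrix}B_M\\0\end{bmatrix}$, $\tilde\Theta:=\Theta(JG_M)^{-1}$, $\Gamma:=\tilde\Theta+\tilde\Theta^\top$; e) there exists $\alpha>0$ such that $\|Fx\|\le\alpha\|Jx\|$ for all $x\in\mathbb{R}^n$ and, for $S:=\tilde\Theta^\top(\Gamma-\mu I_{q_M})^{-1}\tilde\Theta$, $$\frac{\alpha\|JG_L\|}{1-\|FG_L\|}\left(\sqrt{\frac{\max\{0,\lambda_{\max}(S)\}}{\mu-\lambda_{\max}(\Gamma)}}+\big\|(\Gamma-\mu I_{q_M})^{-1}(\tilde\Theta^\top-\mu I_{q_M})\big\|\right)<1 .$$ Then the system $(\Omega)$ with these $L_1,L_2$ is a state estimator for $(\Sigma)$.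
   Context: **System.** The system $(\Sigma)$ is $$\tfrac{d}{dt}Ex(t)=Ax(t)+B_Lf_L(x(t),u(t),y(t))+B_Mf_M(Jx(t),u(t),y(t)),\qquad y(t)=Cx(t)+h(u(t)),$$ where $E,A\in\mathbb{R}^{l\times n}$, $r=\operatorname{rk}E$, $B_L\in\mathbb{R}^{l\times q_L}$, $B_M\in\mathbb{R}^{l\times q_M}$, $J\in\mathbb{R}^{q_M\times n}$ with $\operatorname{rk}J=q_M$, $C\in\mathbb{R}^{p\times n}$; $\mathcal{X}\subseteq\mathbb{R}^n$, $\mathcal{U}\subseteq\mathbb{R}^m$, $\mathcal{Y}\subseteq\mathbb{R}^p$ are open, $\hat{\mathcal{X}}:=J\mathcal{X}\subseteq\mathbb{R}^{q_M}$; $h:\mathcal{U}\to\mathbb{R}^p$, $f_L:\mathcal{X}\times\mathcal{U}\times\mathcal{Y}\to\mathbb{R}^{q_L}$ and $f_M:\hat{\mathcal{X}}\times\mathcal{U}\times\mathcal{Y}\to\mathbb{R}^{q_M}$ are continuous. The nonlinearities satisfy (Lip) $\|f_L(z,u,y)-f_L(x,u,y)\|\le\|F(z-x)\|$ for all $x,z\in\mathcal{X}$, $u\in\mathcal{U}$, $y\in\mathcal{Y}$, with some $F\in\mathbb{R}^{j\times n}$, $j\in\mathbb{N}$; (Mon) $(z-x)^\top\Theta\big(f_M(z,u,y)-f_M(x,u,y)\big)\ge\frac12\mu\|z-x\|^2$ for all $x,z\in\hat{\mathcal{X}}$, $u\in\mathcal{U}$, $y\in\mathcal{Y}$, with some $\Theta\in\mathbb{R}^{q_M\times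 q_M}$, $\mu\in\mathbb{R}$ ($\mu<0$ and singular $\Theta$ are allowed). Set $B:=[B_L,B_M]$ and $f(x,u,y):=\begin{pmatrix}f_L(x,u,y)\\ f_M(Jx,u,y)\end{pmatrix}$. Convention: if only the Lipschitz part $f_L$ is present ($q_M=0$), conditions d) and e) are not present; if only the monotone part $f_M$ is present ($q_L=0$), conditions c) and e) are not present. **Observer candidate.** For $L_1\in\mathbb{R}^{l\times k}$, $L_2\in\mathbb{R}^{p\times k}$ the system $(\Omega)$ is $$\tfrac{d}{dt}Ez(t)=Az(t)+Bf(z(t),u(t),y(t))+L_1d(t),\qquad 0=Cz(t)-y(t)+h(u(t))+L_2d(t),$$ with state $x_o=\binom{z}{d}$ taking values in $\mathcal{X}_o=\mathcal{X}\times\mathbb{R}^k$, inputs $u,y$ and output $z$. **Solutions.** A solution of $(\Sigma)$ on an open interval $I$ is a triple $(x,u,y)\in C(I\to\mathcal{X}\times\mathcal{U}\times\mathcal{Y})$ with $x\in C^1$ satisfying the equations for all $t\in I$. A solution of $(\Omega)$ on $I$ is $\big(\binom{z}{d},\binom{u}{y},z\big)$ with $\binom{z}{d}\in C^1(I\to\mathcal{X}\times\mathbb{R}^k)$, $(u,y)\in C(I\to\mathcal{U}\times\mathcal{Y})$ satisfying the equations for all $t\in I$. The behaviors $\mathfrak{B}_\Sigma,\mathfrak{B}_\Omega$ are the sets of all solutions on all open intervals $I\subseteq\mathbb{R}$. **State estimator.** $(\Omega)$ is an acceptor for $(\Sigma)$ if for every $(x,u,y)\in\mathfrak{B}_\Sigma$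 with domain $I$ there is $\binom{z}{d}\in C^1(I\to\mathcal{X}\times\mathbb{R}^k)$ with $\big(\binom{z}{d},\binom{u}{y},z\big)\in\mathfrak{B}_\Omega$. $(\Omega)$ is a state estimator for $(\Sigma)$ if it is an acceptor for $(\Sigma)$ and for all $t_0\in\mathbb{R}$, whenever $(x,u,y)$ and $\big(\binom{z}{d},\binom{u}{y},z\big)$ (same $u,y$) are solutions of $(\Sigma)$ and $(\Omega)$ on $[t_0,\infty)$ (i.e. restrictions to $[t_0,\infty)$ of elements of $\mathfrak{B}_\Sigma$, $\mathfrak{B}_\Omega$), then $\lim_{t\to\infty}(z(t)-x(t))=0$. **Matrices.** $\mathcal{E}=\begin{bmatrix}E&0\\0&0\end{bmatrix}$, $\mathcal{A}=\begin{bmatrix}A&L_1\\C&L_2\end{bmatrix}$, $\hat A=\begin{bmatrix}A&0\\C&0\end{bmatrix}$ in $\mathbb{R}^{(l+p)\times(n+k)}$; $\mathcal{B}=\begin{bmatrix}B\\0\end{bmatrix}\in\mathbb{R}^{(l+p)\times(q_L+q_M)}$; $H=\begin{bmatrix}0_{n\times n}&0\\0&I_k\end{bmatrix}$; $\mathcal{F}=[F,0]\in\mathbb{R}^{j\times(n+k)}$; $\hat\Theta=\begin{bmatrix}0&J^\top\Theta\\0&0\end{bmatrix}\in\mathbb{R}^{(n+k)\times(q_L+q_M)}$; $\mathcal{J}=\begin{bmatrix}J^\top J&0\\0&0\end{bmatrix}\in\mathbb{R}^{(n+k)\times(n+k)}$; $\Lambda_{q_L}=\begin{bmatrix}I_{q_L}&0\\0&0\end{bmatrix}\in\mathbb{R}^{(q_L+q_M)\times(q_L+q_M)}$.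 $\lambda_{\max}(M)$ denotes the largest eigenvalue of $M$; $\|\cdot\|$ is the Euclidean norm and the induced matrix norm. **Wong limits.** For matrices $M,N$ of equal size $a\times b$: $\mathcal{V}^0_{[M,N]}:=\mathbb{R}^b$, $\mathcal{V}^{i+1}_{[M,N]}:=N^{-1}(M\mathcal{V}^i_{[M,N]})$, $\mathcal{V}^*_{[M,N]}:=\bigcap_{i\in\mathbb{N}_0}\mathcal{V}^i_{[M,N]}$; $\mathcal{W}^0_{[M,N]}:=\{0\}$, $\mathcal{W}^{i+1}_{[M,N]}:=M^{-1}(N\mathcal{W}^i_{[M,N]})$, $\mathcal{W}^*_{[M,N]}:=\bigcup_{i\in\mathbb{N}_0}\mathcal{W}^i_{[M,N]}$ (with $M^{-1},N^{-1}$ denoting preimages). $\overline{\mathcal{V}}^*_{[[\mathcal{E},0],[\mathcal{A},\mathcal{B}]]}:=[I_{n+k},0]\,\mathcal{V}^*_{[[\mathcal{E},0],[\mathcal{A},\mathcal{B}]]}$, where $[\mathcal{E},0],[\mathcal{A},\mathcal{B}]\in\mathbb{R}^{(l+p)\times(n+k+q_L+q_M)}$. **Regularity and index.** A square pencil $sM-N\in\mathbb{R}[s]^{a\times a}$ is regular if $\det(sM-N)\ne0\in\mathbb{R}[s]$. Then there are invertible $S_0,T_0\in\mathbb{R}^{a\times a}$ with $S_0(sM-N)T_0=s\begin{bmatrix}I_\rho&0\\0&N_0\end{bmatrix}-\begin{bmatrix}J_0&0\\0&I_{a-\rho}\end{bmatrix}$, $N_0$ nilpotent; the index is $0$ if $\rho=a$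 and $\min\{i\in\mathbb{N}: N_0^i=0\}$ if $\rho<a$ (independent of the choice of $S_0,T_0$). **Definiteness on a subspace.** $M<_V0$ means $x^\top Mx<0$ for all $x\in V\setminus\{0\}$; $M\ge_V0$ means $x^\top Mx\ge0$ for all $x\in V$. *)

(* Defs.v *)
From HB Require Import structures.
From mathcomp Require Import all_boot all_order all_algebra.
From mathcomp Require Import all_classical all_reals all_analysis.

Set Implicit Arguments.
Unset Strict Implicit.
Unset Printing Implicit Defensive.

Import Order.TTheory GRing.Theory Num.Theory.
Import numFieldNormedType.Exports.

Local Open Scope classical_set_scope.
Local Open Scope ring_scope.

(* The library norm of a matrix is the maximum of the absolute values of its
   entries (same topology), hence the next two definitions. *)
Definition enorm (R : realType) (n : nat) (x : 'cV[R]_n) : R :=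
  Num.sqrt (\sum_i x i 0 ^+ 2).

Definition opnorm (R : realType) (a b : nat) (M : 'M[R]_(a, b)) : R :=
  sup [set enorm (M *m x) | x in [set x : 'cV[R]_b | enorm x <= 1]].

(* Only used for symmetric matrices of positive size, whose set of (real)
   eigenvalues is finite and nonempty, so that the supremum is a maximum. *)
Definition lambda_max (R : realType) (a : nat) (M : 'M[R]_a) : R :=
  sup [set x : R | eigenvalue M x].

Definition qform (R : realType) (a : nat) (M : 'M[R]_a) (x : 'cV[R]_a) : R :=
  (x^T *m M *m x) 0 0.

Definition neg_on (R : realType) (a : nat) (S : set 'cV[R]_a) (M : 'M[R]_a) :=
  forall x, S x -> x != 0 -> qform M x < 0.

Definition nonneg_on (R : realType) (a : nat) (S : set 'cV[R]_a)
    (M : 'M[R]_a) :=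
  forall x, S x -> 0 <= qform M x.

(* Invertibility for matrices whose two dimensions are equal, but not
   syntactically so. *)
Definition invertible (K : fieldType) (a b : nat) (M : 'M[K]_(a, b)) :=
  exists N : 'M[K]_(b, a), M *m N = 1%:M /\ N *m M = 1%:M.

(* On such matrices the library's pinvmx is the inverse. *)
Lemma pinvmx_inverse (K : fieldType) (a b : nat) (M : 'M[K]_(a, b)) :
  invertible M -> M *m pinvmx M = 1%:M /\ pinvmx M *m M = 1%:M.
Proof.
move=> [N [MN NM]]; split.
  by apply: mulmxVp; apply/row_freeP; exists N.
by apply: mulVpmx; apply/row_fullP; exists N.
Qed.

Definition basis_matrix (R : realType) (b d : nat) (S : set 'cV[R]_b)
    (V : 'M[R]_(b, d)) :=
  \rank V = d /\ range (fun x : 'cV[R]_d => V *m x) = S.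

Section Wong.
Context (R : realType) (a b : nat) (M N : 'M[R]_(a, b)).

Fixpoint wongV_seq (i : nat) : set 'cV[R]_b :=
  if i is i'.+1 then
    (fun x : 'cV[R]_b => N *m x) @^-1`
      ((fun x : 'cV[R]_b => M *m x) @` wongV_seq i')
  else setT.

Fixpoint wongW_seq (i : nat) : set 'cV[R]_b :=
  if i is i'.+1 then
    (fun x : 'cV[R]_b => M *m x) @^-1`
      ((fun x : 'cV[R]_b => N *m x) @` wongW_seq i')
  else [set 0].

Definition wongV : set 'cV[R]_b := \bigcap_i wongV_seq i.
Definition wongW : set 'cV[R]_b := \bigcup_i wongW_seq i.

End Wong.

Section Pencil.
Context (R : realType).

Definition pencil (a b : nat) (M N : 'M[R]_(a, b)) : 'M[{poly R}]_(a, b) :=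
  'X *: map_mx polyC M - map_mx polyC N.

(* The pencil is square; the equality of dimensions need not be syntactic. *)
Definition regular_pencil (a b : nat) (M N : 'M[R]_(a, b)) :=
  exists e : b = a, \det (castmx (erefl a, e) (pencil M N)) != 0.

(* nu is the index of the regular pencil sM - N; rho + sg is its size. *)
Definition is_index (a b : nat) (M N : 'M[R]_(a, b)) (nu : nat) :=
  exists (rho sg : nat) (S0 : 'M[R]_(rho + sg, a)) (T0 : 'M[R]_(b, rho + sg))
         (J0 : 'M[R]_rho) (N0 : 'M[R]_sg),
    [/\ invertible S0 /\ invertible T0,
        map_mx polyC S0 *m pencil M N *m map_mx polyC T0 =
          pencil (block_mx 1%:M 0 0 N0) (block_mx J0 0 0 1%:M),
        exists i : nat, N0 ^+ i = 0,
        sg = 0%N -> nu = 0%N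
      & (0 < sg)%N ->
          [/\ (0 < nu)%N, N0 ^+ nu = 0
            & forall i : nat, (0 < i)%N -> N0 ^+ i = 0 -> (nu <= i)%N]].

End Pencil.

(* The nonlinearities are total functions, constrained on the sets sX, sU, sY
   only; Xhat is the image of sX under sJ. *)
Record da_system (R : realType) (l n m p qL qM : nat) := DASystem {
  sE : 'M[R]_(l, n);
  sA : 'M[R]_(l, n);
  sBL : 'M[R]_(l, qL);
  sBM : 'M[R]_(l, qM);
  sJ : 'M[R]_(qM, n);
  sC : 'M[R]_(p, n);
  sX : set 'cV[R]_n;
  sU : set 'cV[R]_m;
  sY : set 'cV[R]_p;
  sh : 'cV[R]_m -> 'cV[R]_p;
  sfL : 'cV[R]_n -> 'cV[R]_m -> 'cV[R]_p -> 'cV[R]_qL;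
  sfM : 'cV[R]_qM -> 'cV[R]_m -> 'cV[R]_p -> 'cV[R]_qM;
  Xhat := [set sJ *m x | x in sX] : set 'cV[R]_qM;
  rank_sJ : \rank sJ = qM;
  open_sX : open sX;
  open_sU : open sU;
  open_sY : open sY;
  cont_sh : {within sU, continuous sh};
  cont_sfL : {within sX `*` sU `*` sY,
    continuous (fun w : 'cV[R]_n * 'cV[R]_m * 'cV[R]_p =>
                  sfL w.1.1 w.1.2 w.2)};
  cont_sfM : {within Xhat `*` sU `*` sY,
    continuous (fun w : 'cV[R]_qM * 'cV[R]_m * 'cV[R]_p =>
                  sfM w.1.1 w.1.2 w.2)}
}.

Section System.
Context (R : realType) (l n m p qL qM : nat).
Variable s : da_system R l n m p qL qM.

Definition lipschitz_cond (j : nat) (F : 'M[R]_(j, n)) :=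
  forall x z u y, sX s x -> sX s z -> sU s u -> sY s y ->
    enorm (sfL s z u y - sfL s x u y) <= enorm (F *m (z - x)).

Definition monotone_cond (Theta : 'M[R]_qM) (mu : R) :=
  forall x z u y, Xhat s x -> Xhat s z -> sU s u -> sY s y ->
    2^-1 * mu * enorm (z - x) ^+ 2 <=
      ((z - x)^T *m Theta *m (sfM s z u y - sfM s x u y)) 0 0.

Definition sB : 'M[R]_(l, qL + qM) := row_mx (sBL s) (sBM s).

Definition sf (x : 'cV[R]_n) (u : 'cV[R]_m) (y : 'cV[R]_p) : 'cV[R]_(qL + qM) :=
  col_mx (sfL s x u y) (sfM s (sJ s *m x) u y).

(* Trajectories are total functions of time, of which only the values on the
   time domain matter. *)
Definition open_interval (I : set R) := is_interval I /\ open I.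

Definition C1_on (a : nat) (I : set R) (x : R -> 'cV[R]_a) :=
  (forall t, I t -> derivable x t 1) /\ {within I, continuous (derive1 x)}.

Definition sigma_sol (I : set R)
    (x : R -> 'cV[R]_n) (u : R -> 'cV[R]_m) (y : R -> 'cV[R]_p) :=
  [/\ C1_on I x,
      {within I, continuous u} /\ {within I, continuous y},
      forall t, I t -> [/\ sX s (x t), sU s (u t) & sY s (y t)]
    & forall t, I t ->
        derive1 (fun r => sE s *m x r) t =
          sA s *m x t + sBL s *m sfL s (x t) (u t) (y t)
          + sBM s *m sfM s (sJ s *m x t) (u t) (y t)
        /\ y t = sC s *m x t + sh s (u t)].

Section Observer.
Context (k : nat).
Variables (L1 : 'M[R]_(l, k)) (L2 : 'M[R]_(p, k)).

Definition omega_sol (I : set R) (z : R -> 'cV[R]_n) (d : R -> 'cV[R]_k)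
    (u : R -> 'cV[R]_m) (y : R -> 'cV[R]_p) :=
  [/\ C1_on I z /\ C1_on I d,
      {within I, continuous u} /\ {within I, continuous y},
      forall t, I t -> [/\ sX s (z t), sU s (u t) & sY s (y t)]
    & forall t, I t ->
        derive1 (fun r => sE s *m z r) t =
          sA s *m z t + sB *m sf (z t) (u t) (y t) + L1 *m d t
        /\ 0 = sC s *m z t - y t + sh s (u t) + L2 *m d t].

Definition acceptor :=
  forall (I : set R) x u y, open_interval I -> sigma_sol I x u y ->
    exists (z : R -> 'cV[R]_n) (d : R -> 'cV[R]_k), omega_sol I z d u y.

(* Solutions on [t0, +oo[: restrictions of solutions on open intervals. *)
Definition sigma_sol_from (t0 : R)
    (x : R -> 'cV[R]_n) (u : R -> 'cV[R]_m) (y : R -> 'cV[R]_p) :=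
  exists (I : set R) x' u' y',
    [/\ open_interval I, `[t0, +oo[ `<=` I, sigma_sol I x' u' y'
      & forall t, t0 <= t -> [/\ x t = x' t, u t = u' t & y t = y' t]].

Definition omega_sol_from (t0 : R) (z : R -> 'cV[R]_n) (d : R -> 'cV[R]_k)
    (u : R -> 'cV[R]_m) (y : R -> 'cV[R]_p) :=
  exists (I : set R) z' d' u' y',
    [/\ open_interval I, `[t0, +oo[ `<=` I, omega_sol I z' d' u' y'
      & forall t, t0 <= t ->
          [/\ z t = z' t, d t = d' t, u t = u' t & y t = y' t]].

Definition state_estimator :=
  acceptor /\
  forall (t0 : R) x z d u y,
    sigma_sol_from t0 x u y -> omega_sol_from t0 z d u y ->
    (z t - x t) @[t --> +oo] --> (0 : 'cV[R]_n).

Definition calA : 'M[R]_(l + p, n + k) := block_mx (sA s) L1 (sC s) L2.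

End Observer.

Definition calE (k : nat) : 'M[R]_(l + p, n + k) := block_mx (sE s) 0 0 0.

Definition hatA (k : nat) : 'M[R]_(l + p, n + k) :=
  block_mx (sA s) 0 (sC s) 0.

Definition calB : 'M[R]_(l + p, qL + qM) := col_mx sB 0.

Definition hatTheta (k : nat) (Theta : 'M[R]_qM) : 'M[R]_(n + k, qL + qM) :=
  block_mx 0 ((sJ s)^T *m Theta) 0 0.

Definition calJ (k : nat) : 'M[R]_(n + k) :=
  block_mx ((sJ s)^T *m sJ s) 0 0 0.

End System.

Definition matH (R : realType) (n k : nat) : 'M[R]_(n + k) :=
  block_mx 0 0 0 1%:M.

Definition calF (R : realType) (j n k : nat) (F : 'M[R]_(j, n)) :
  'M[R]_(j, n + k) := row_mx F 0.

Definition Lambda (R : realType) (qL qM : nat) : 'M[R]_(qL + qM) :=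
  block_mx 1%:M 0 0 0.

(* - [I_n, 0] W [0, I] [cE V, cA W]^-1 [B0; 0], used with B0 the matrices B_L
   and B_M.  For a regular pencil s cE - cA of index at most one and basis
   matrices V, W of its Wong limits, [cE V, cA W] is square and invertible,
   and its block widths are d1 = rk cE and d2 = n + k - rk cE. *)
Definition gain (R : realType) (l p n k d1 d2 q : nat)
    (cE cA : 'M[R]_(l + p, n + k))
    (V : 'M[R]_(n + k, d1)) (W : 'M[R]_(n + k, d2)) (B0 : 'M[R]_(l, q)) :
    'M[R]_(n, q) :=
  - ((row_mx 1%:M 0 : 'M[R]_(n, n + k)) *m W
     *m (row_mx 0 1%:M : 'M[R]_(d2, d1 + d2))
     *m pinvmx (row_mx (cE *m V) (cA *m W))
     *m (col_mx B0 0 : 'M[R]_(l + p, q))).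

(* Main.v *)
Require Import Defs.
From HB Require Import structures.
From mathcomp Require Import all_boot all_order all_algebra.
From mathcomp Require Import all_classical all_reals all_analysis.
From mathcomp Require Import ring lra.

Import Order.TTheory GRing.Theory Num.Theory.
Import numFieldNormedType.Exports.

Local Open Scope classical_set_scope.
Local Open Scope ring_scope.

Set Implicit Arguments.
Unset Strict Implicit.

(** Let w = (z - x, d) be the error of the observer and phi the difference
    f(z,u,y) - f(x,u,y).  They satisfy the linear descriptor equation
    cE w' = cA w + cB phi.  Acceptance is immediate (take z = x and d = 0), so
    the point is that w tends to 0.

    The pair xi = (w, phi) takes its values in the Wong limit VV of
    [[cE, 0]] and [[cA, cB]] ([wongV_trajectory]): as long as xi stays in a
    subspace, cE w stays in the image of that subspace by [[cE, 0]], and so does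
    its derivative [[cA, cB]] xi.  On VV the function v = w^T cE^T P w is
    nonnegative.  Its derivative 2 w^T P^T (cA w + cB phi) is at most
    xi^T Q xi by (Lip) and (Mon) ([dissipation_inequality]), hence at most
    - c |xi|^2 by compactness of the sphere.  Since v is bounded by a multiple
    of |xi|^2, it decays exponentially.

    The form cE^T P is only semidefinite, so that v -> 0 does not give w -> 0 by
    itself.  The missing estimate |xi|^2 <= K v comes from the dissipation
    inequality once more ([lyapunov_comparison]).  A decreasing sequence of
    subspaces is stationary, whence VV is invariant: cA w + cB phi = cE w1 for
    some w1 in the projection of VV that depends linearly on xi
    ([wongV_basis]).  Then v' = 2 beta(w, w1), where beta is the semidefinite
    form of cE^T P, and Cauchy and Schwarz give
    c |xi|^2 <= 2 |beta(w, w1)| <= C (sqrt v) |xi|. *)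

(** * The Wong limit as an invariant subspace *)

Section WongBasis.
Context (R : realType) (a b : nat) (M N : 'M[R]_(a, b)).

(** The members of the Wong sequence as row spaces, which gives access to their
    ranks; [kermx (_ *m cokermx _)] is the preimage of a row space. *)
Fixpoint wong_mx (i : nat) : 'M[R]_b :=
  if i is i'.+1 then kermx (N^T *m cokermx (wong_mx i' *m M^T)) else 1%:M.

Lemma wongV_seqE i x : wongV_seq M N i x <-> (x^T <= wong_mx i)%MS.
Proof.
elim: i x => [|i IHi] x /=; first by split=> _; rewrite ?submx1.
rewrite sub_kermx mulmxA -submxE.
split=> [[y /IHi yG MyNx]|/submxP[D xD]].
  by rewrite -trmx_mul -MyNx trmx_mul submxMr.
exists (D *m wong_mx i)^T; first by apply/IHi; rewrite trmxK submxMl.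
by apply: trmx_inj; rewrite !trmx_mul !trmxK xD mulmxA.
Qed.

Lemma wongV_seq_decr i : wongV_seq M N i.+1 `<=` wongV_seq M N i.
Proof.
elim: i => [|i IHi] x //= [y ys <-].
by exists y => //; exact: IHi.
Qed.

Lemma wongV_seq_le i j : (i <= j)%N -> wongV_seq M N j `<=` wongV_seq M N i.
Proof.
move=> ij; rewrite -(subnK ij); elim: (j - i)%N => [|e IHe] //.
by rewrite addSn; apply: subset_trans IHe; exact: wongV_seq_decr.
Qed.

Lemma wong_mx_le i j : (i <= j)%N -> (wong_mx j <= wong_mx i)%MS.
Proof.
move=> ij; apply/row_subP => r.
rewrite -[row r _]trmxK; apply/wongV_seqE; apply: (wongV_seq_le ij).
by apply/wongV_seqE; rewrite trmxK row_sub.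
Qed.

(** The ranks of a decreasing sequence of subspaces have a minimum, and from
    where it is attained on the sequence is constant. *)
Lemma wongV_stationary : exists i, wongV M N = wongV_seq M N i.
Proof.
have ex_r : exists r, `[< exists i, \rank (wong_mx i) = r >].
  by exists (\rank (wong_mx 0)); apply/asboolP; exists 0%N.
have [r /asboolP[i rk_i] r_min] := ex_minnP ex_r.
exists i; apply/seteqP; split=> [x Vx|x Vix j _]; first exact: Vx.
have [ij|/ltnW ji] := leqP i j; last exact: wongV_seq_le ji x Vix.
apply/wongV_seqE; move/wongV_seqE: Vix => /submx_trans; apply.
rewrite -(geq_leqif (mxrank_leqif_sup (wong_mx_le ij))) rk_i.
by apply: r_min; apply/asboolP; exists j.
Qed.

(** Two consecutive members of the sequence agree at the stage where it becomes
    stationary, so that [N] maps the limit into its image by [M]; the matrix [Y]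
    expresses this in coordinates, linearly and hence with a bound. *)
Lemma wongV_basis : exists (d : nat) (X : 'M[R]_(b, d)) (Y : 'M[R]_d),
  basis_matrix (wongV M N) X /\ N *m X = M *m X *m Y.
Proof.
have [i Vi] := wongV_stationary.
pose G := row_base (wong_mx i).
have VP x : wongV M N x <-> (x^T <= G)%MS.
  by rewrite Vi wongV_seqE eq_row_base.
have NG : (G *m N^T <= G *m M^T)%MS.
  apply/row_subP => r; rewrite row_mul.
  have /VP : ((row r G)^T^T <= G)%MS by rewrite trmxK row_sub.
  move=> /(_ i.+1 I) [y yi MyN].
  have yG : (y^T <= G)%MS by apply/VP; rewrite Vi.
  by rewrite -[row r G]trmxK -trmx_mul -MyN trmx_mul submxMr.
have [D defNG] := submxP NG.
exists _, G^T, D^T; split; last first.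
  by apply: trmx_inj; rewrite !trmx_mul !trmxK defNG.
split; first by rewrite mxrank_tr; apply/eqP; exact: row_base_free.
apply/seteqP; split=> [_ [v _ <-]|x /VP /submxP[v xv]].
  by apply/VP; rewrite trmx_mul trmxK submxMl.
by exists v^T => //; apply: trmx_inj; rewrite trmx_mul !trmxK.
Qed.

End WongBasis.

(** * Derivatives of matrix expressions *)

Section Derivatives.
Context (R : realType).

Lemma is_derive_mulmx a b c (X : R -> 'M[R]_(a, b)) (Y : R -> 'M[R]_(b, c)) t :
  derivable X t 1 -> derivable Y t 1 ->
  is_derive t (1 : R) (fun r => X r *m Y r)
    (derive1 X t *m Y t + X t *m derive1 Y t).
Proof.
move=> dX dY.
have dXY i j : is_derive t (1 : R) (fun r => (X r *m Y r) i j)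
    ((derive1 X t *m Y t + X t *m derive1 Y t) i j).
  have -> : (fun r => (X r *m Y r) i j) =
      \sum_(e < b) (fun r => X r i e * Y r e j).
    by apply/funext => r; rewrite fct_sumE mxE.
  rewrite !derive1E (derive_mx dX) (derive_mx dY) !mxE -big_split /=.
  apply: is_derive_sum => e; rewrite !mxE.
  have /derivable_mxP/(_ i e) dXe := dX.
  have /derivable_mxP/(_ e j) dYe := dY.
  rewrite addrC [X in _ + X]mulrC.
  exact: (is_deriveM (derivableP dXe) (derivableP dYe)).
have D : derivable (fun r => X r *m Y r) t 1.
  by apply/derivable_mxP => i j; case: (dXY i j).
apply: DeriveDef => //; rewrite (derive_mx D).
by apply/matrixP => i j; rewrite mxE derive_val.
Qed.

Lemma is_derive_mulmxl a b c (M : 'M[R]_(a, b)) (X : R -> 'M[R]_(b, c)) t :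
  derivable X t 1 ->
  is_derive t (1 : R) (fun r => M *m X r) (M *m derive1 X t).
Proof.
move=> dX; have := is_derive_mulmx (derivable_cst M t 1) dX.
by rewrite derive1_cst mul0mx add0r.
Qed.

Lemma is_derive_trmx a b (X : R -> 'M[R]_(a, b)) t :
  derivable X t 1 -> is_derive t (1 : R) (fun r => (X r)^T) (derive1 X t)^T.
Proof.
move=> dX.
have dXT : derivable (fun r => (X r)^T) t 1.
  apply/derivable_mxP => i j; move/derivable_mxP/(_ j i): dX.
  by congr (derivable _ t 1); apply/funext => r; rewrite mxE.
apply: DeriveDef => //; rewrite derive1E (derive_mx dX) (derive_mx dXT).
apply/matrixP => i j; rewrite !mxE; congr ('D_1 _ t).
by apply/funext => r; rewrite mxE.
Qed.

Lemma is_derive_col_mx a1 a2 b (X : R -> 'M[R]_(a1, b))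
    (Y : R -> 'M[R]_(a2, b)) t :
  derivable X t 1 -> derivable Y t 1 ->
  is_derive t (1 : R) (fun r => col_mx (X r) (Y r))
    (col_mx (derive1 X t) (derive1 Y t)).
Proof.
move=> dX dY.
have splitE (x : 'M[R]_(a1, b)) (y : 'M[R]_(a2, b)) :
    col_mx x y = col_mx 1%:M 0 *m x + col_mx 0 1%:M *m y.
  by rewrite !mul_col_mx !mul1mx !mul0mx add_col_mx addr0 add0r.
have -> : (fun r => col_mx (X r) (Y r)) =
    (fun r => col_mx 1%:M 0 *m X r) + (fun r => col_mx 0 1%:M *m Y r).
  by apply/funext => r; rewrite splitE.
rewrite splitE.
exact: is_deriveD (is_derive_mulmxl _ dX) (is_derive_mulmxl _ dY).
Qed.

End Derivatives.

(** * Quadratic forms *)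

Section QuadraticForms.
Context (R : realType).

Lemma bilinear_tr a b (M : 'M[R]_(a, b)) (x : 'cV[R]_a) (y : 'cV[R]_b) :
  (x^T *m M *m y) 0 0 = (y^T *m M^T *m x) 0 0.
Proof. by rewrite -[in LHS](trmxK (_ *m _)) mxE !trmx_mul trmxK mulmxA. Qed.

Lemma enorm_sqr a (x : 'cV[R]_a) : enorm x ^+ 2 = (x^T *m x) 0 0.
Proof.
rewrite /enorm sqr_sqrtr; last by apply: sumr_ge0 => i _; exact: sqr_ge0.
by rewrite mxE; apply: eq_bigr => i _; rewrite mxE expr2.
Qed.

Lemma sqr_coord_le a (x : 'cV[R]_a) i : x i 0 ^+ 2 <= enorm x ^+ 2.
Proof.
rewrite /enorm sqr_sqrtr; last by apply: sumr_ge0 => e _; exact: sqr_ge0.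
by rewrite (bigD1 i) //= lerDl; apply: sumr_ge0 => e _; exact: sqr_ge0.
Qed.

Lemma enorm_gt0 a (x : 'cV[R]_a) : x != 0 -> 0 < enorm x ^+ 2.
Proof.
move=> x0; rewrite lt0r sqr_ge0 andbT; apply: contra x0 => /eqP xx0.
apply/eqP/matrixP => i e; rewrite (ord1 e) mxE; apply/eqP.
by rewrite -sqrf_eq0 eq_le sqr_ge0 -{1}xx0 sqr_coord_le.
Qed.

Lemma qformZ a (M : 'M[R]_a) r x : qform M (r *: x) = r ^+ 2 * qform M x.
Proof.
by rewrite /qform [_^T]linearZ /=  -!scalemxAl -scalemxAr scalerA mxE expr2.
Qed.

Lemma qform0 a (M : 'M[R]_a) : qform M 0 = 0.
Proof. by rewrite /qform mulmx0 mxE. Qed.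

Lemma qformD a (M N : 'M[R]_a) x : qform (M + N) x = qform M x + qform N x.
Proof. by rewrite /qform mulmxDr mulmxDl mxE. Qed.

Lemma qform_scale a r (M : 'M[R]_a) x : qform (r *: M) x = r * qform M x.
Proof. by rewrite /qform -scalemxAr -scalemxAl mxE. Qed.

Lemma qform_tr a (M : 'M[R]_a) x : qform M^T x = qform M x.
Proof. by rewrite /qform [RHS]bilinear_tr. Qed.

Lemma qform_gram a b (M : 'M[R]_(a, b)) x :
  qform (M^T *m M) x = enorm (M *m x) ^+ 2.
Proof. by rewrite enorm_sqr /qform trmx_mul !mulmxA. Qed.

Lemma qform_block a b (M : 'M[R]_a) (N : 'M[R]_(a, b)) (S : 'M[R]_b) x y :
  qform (block_mx M N N^T S) (col_mx x y) =
    qform M x + 2 * (x^T *m N *m y) 0 0 + qform S y.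
Proof.
have addE (p q : 'M[R]_1) : (p + q) 0 0 = p 0 0 + q 0 0 by rewrite mxE.
rewrite /qform tr_col_mx mul_row_block mul_row_col !mulmxDl !addE.
rewrite [(y^T *m _^T *m _) 0 0]bilinear_tr trmxK.
by ring.
Qed.

Lemma qform_mul a b (M : 'M[R]_a) (X : 'M[R]_(a, b)) x :
  qform M (X *m x) = qform (X^T *m M *m X) x.
Proof. by rewrite /qform trmx_mul !mulmxA. Qed.

Lemma qform_sum a (M : 'M[R]_a) x :
  qform M x = \sum_i \sum_e x i 0 * M i e * x e 0.
Proof.
rewrite /qform mxE exchange_big; apply: eq_bigr => e _.
by rewrite mxE mulr_suml; apply: eq_bigr => i _; rewrite mxE.
Qed.

Lemma qform_le a (M : 'M[R]_a) :
  exists2 C, 0 < C & forall x, qform M x <= C * enorm x ^+ 2.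
Proof.
exists (1 + \sum_i \sum_e `|M i e|) => [|x].
  by rewrite ltr_pwDl //; apply: sumr_ge0 => i _; apply: sumr_ge0.
rewrite qform_sum mulrDl mul1r mulr_suml ler_wpDl ?sqr_ge0 //.
apply: ler_sum => i _; rewrite mulr_suml; apply: ler_sum => e _.
have xie : `|x i 0 * x e 0| <= enorm x ^+ 2.
  rewrite normrM.
  have := sqr_coord_le x i; have := sqr_coord_le x e.
  rewrite -(real_normK (num_real (x e 0))) -(real_normK (num_real (x i 0))).
  nra.
apply: le_trans (ler_norm _) _.
by rewrite mulrAC normrM mulrC ler_wpM2l.
Qed.

Lemma qform_continuous a (M : 'M[R]_a) :
  continuous (fun u : 'rV[R]_a => qform M u^T).
Proof.
have -> : (fun u : 'rV[R]_a => qform M u^T) =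
    (fun u => \sum_i \sum_e u 0 i * M i e * u 0 e).
  apply/funext => u; rewrite qform_sum; apply: eq_bigr => i _.
  by apply: eq_bigr => e _; rewrite !mxE.
have coord_cont (i : 'I_a) : continuous (fun u : 'rV[R]_a => u 0 i).
  by move=> u; exact: coord_continuous.
apply: continuous_big => [|i _]; first exact: add_continuous.
apply: continuous_big => [|e _ u]; first exact: add_continuous.
pose ui_M := continuousM (coord_cont i u)
  (@cst_continuous 'rV[R]_a R (M i e) u).
exact: (continuousM ui_M (coord_cont e u)).
Qed.

(** Compactness of the unit sphere makes negativity uniform. *)
Lemma negative_qform_le a (N : 'M[R]_a) :
  (forall x, x != 0 -> qform N x < 0) ->
  exists2 c, 0 < c & forall x, qform N x <= - (c * enorm x ^+ 2).
Proof.
move=> Nneg; pose S := [set u : 'rV[R]_a | qform 1%:M u^T = 1].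
have sq1 (x : 'cV[R]_a) : qform 1%:M x = enorm x ^+ 2.
  by rewrite /qform mulmx1 enorm_sqr.
have normalized (x : 'cV[R]_a) : x != 0 -> S ((enorm x)^-1 *: x)^T.
  move=> /enorm_gt0 x0; rewrite /S /= trmxK qformZ sq1 exprVn mulVf //.
  by rewrite gt_eqF.
have [S0|S0] := pselect (S !=set0); last first.
  exists 1 => // x; have [->|x0] := eqVneq x 0; last first.
    by exfalso; apply: S0; exists ((enorm x)^-1 *: x)^T; exact: normalized.
  by rewrite -sq1 !qform0 mulr0 oppr0.
have Sc : compact S.
  apply: bounded_closed_compact.
    exists 1; split=> [|r r1 u Su]; first exact: num_real.
    apply: le_trans (ltW r1); rewrite [leLHS]/Num.Def.normr /= mx_normrE.
    apply: bigmax_le => //= -[i e] _ /=; rewrite (ord1 i).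
    have := sqr_coord_le u^T e; rewrite -sq1 Su mxE.
    by rewrite -(real_normK (num_real (u 0 e))) expr_le1.
  apply: (preimage_closed _ (@closed_eq R 1)) => u _; exact: qform_continuous.
have [u uS umax] := compact_EVT_max S0 Sc
  (continuous_subspaceT (@qform_continuous a N)).
have u0 : u^T != 0.
  apply/eqP => u0; move: uS; rewrite inE /S /= u0 qform0.
  by move=> /eqP; rewrite eq_sym oner_eq0.
exists (- qform N u^T) => [|x]; first by rewrite oppr_gt0 Nneg.
rewrite mulNr opprK; have [->|x0] := eqVneq x 0.
  by rewrite -sq1 !qform0 mulr0.
have := umax _ (mem_set (normalized _ x0)).
by rewrite trmxK qformZ exprVn ler_pdivrMl ?enorm_gt0 // mulrC.
Qed.

(** Here [qform B] is a Lyapunov function, [2 * (v^T *m B *m (Y *m v)) 0 0] its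
    rate of change and [qform N] an upper bound of that rate.  Although [B] may
    be singular, it controls the norm of the vectors [v] with this dissipation
    inequality: by Cauchy and Schwarz the rate is small whenever [qform B v] is.
    The proof replaces Cauchy and Schwarz by the nonnegativity of [B] at
    [v + la *: (Y *m v)] for a suitable weight [la]. *)
Lemma lyapunov_comparison a (B Y N : 'M[R]_a) :
    B^T = B -> (forall v, 0 <= qform B v) ->
    (forall v, v != 0 -> qform N v < 0) ->
  exists K c : R, [/\ 0 < K, 0 < c & forall v,
    2 * (v^T *m B *m (Y *m v)) 0 0 <= qform N v ->
    enorm v ^+ 2 <= K * qform B v /\
    2 * (v^T *m B *m (Y *m v)) 0 0 <= - (c * qform B v)].
Proof.
move=> BT B0 /negative_qform_le[c0 c0_gt0 Nle].
have [C C_gt0 BC] := qform_le B.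
have [D D_gt0 BD] := qform_le (Y^T *m B *m Y).
exists (4 * D / c0 ^+ 2), (c0 / C).
split; rewrite ?divr_gt0 ?mulr_gt0 ?exprn_gt0 //.
move=> v /le_trans/(_ (Nle v)) vN; set g := (X in 2 * X) in vN *.
split; last first.
  apply: le_trans vN _; rewrite lerN2 -mulrA ler_pM2l // mulrC ler_pdivrMr //.
  by rewrite mulrC.
(* With this weight the quadratic term [la ^+ 2 * D] absorbs only half of the
   gain [la * c0] of the linear term. *)
pose la := c0 / (2 * D).
have expand : qform B (v + la *: (Y *m v)) =
    qform B v + la * (2 * g) + la ^+ 2 * qform (Y^T *m B *m Y) v.
  have addE (p q : 'M[R]_1) : (p + q) 0 0 = p 0 0 + q 0 0 by rewrite mxE.
  have scaleE r (p : 'M[R]_1) : (r *: p) 0 0 = r * p 0 0 by rewrite mxE.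
  rewrite -qform_mul /g /qform [_^T]linearD /= [(la *: _)^T]linearZ /=.
  rewrite !(mulmxDl, mulmxDr) -!(scalemxAl, scalemxAr) !(addE, scaleE).
  rewrite [((Y *m v)^T *m B *m v) 0 0]bilinear_tr BT.
  by ring.
have := B0 (v + la *: (Y *m v)); rewrite expand => ge0.
have la_gt0 : 0 < la by rewrite divr_gt0 // mulr_gt0.
have h1 : la * (2 * g) <= la * - (c0 * enorm v ^+ 2) by rewrite ler_pM2l.
have h2 : la ^+ 2 * qform (Y^T *m B *m Y) v <= la ^+ 2 * (D * enorm v ^+ 2).
  by rewrite ler_pM2l // exprn_gt0.
have h3 : la ^+ 2 * (D * enorm v ^+ 2) = la * c0 / 2 * enorm v ^+ 2.
  by rewrite /la; field; rewrite gt_eqF.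
have h4 : (4 * D / c0 ^+ 2) * (la * c0 / 2) = 1.
  by rewrite /la; field; rewrite !gt_eqF.
have h5 : (la * c0 / 2) * enorm v ^+ 2 <= qform B v by nra.
have -> : enorm v ^+ 2 = 4 * D / c0 ^+ 2 * (la * c0 / 2 * enorm v ^+ 2).
  by rewrite [RHS]mulrA h4 mul1r.
rewrite ler_pM2l //.
by rewrite divr_gt0 ?exprn_gt0 ?mulr_gt0.
Qed.

Lemma is_derive_qform a (M : 'M[R]_a) (w : R -> 'cV[R]_a) t :
  M^T = M -> derivable w t 1 ->
  is_derive t (1 : R) (fun r => qform M (w r))
    (2 * ((w t)^T *m M *m derive1 w t) 0 0).
Proof.
move=> MT dw; rewrite /qform.
have dwT := is_derive_trmx dw.
have dMw := is_derive_mulmxl M dw.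
have D := is_derive_mulmx (@ex_derive _ _ _ _ _ _ _ dwT)
  (@ex_derive _ _ _ _ _ _ _ dMw).
have Dqf := @ex_derive _ _ _ _ _ _ _ D.
apply: DeriveDef.
  move/derivable_mxP/(_ 0 0): Dqf; congr (derivable _ t 1).
  by apply/funext => r; rewrite mulmxA.
have := @derive_val _ _ _ _ _ _ _ D.
rewrite (derive_mx Dqf) => /matrixP/(_ 0 0).
rewrite mxE.
under eq_fun do rewrite mulmxA.
move=> ->; rewrite mxE !derive1E !derive_val -!derive1E.
rewrite !mulmxA [X in X + _ = _]bilinear_tr MT.
by rewrite mulr_natl.
Qed.

End QuadraticForms.

(** * Trajectories *)

Section Asymptotics.
Context (R : realType).

(** The differential inequality makes [expR (c * t) * f t] nonincreasing. *)
Lemma exponential_decay (f : R -> R) (c t0 : R) :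
    0 < c -> (forall t, t0 < t -> derivable f t 1) ->
    (forall t, t0 < t -> 0 <= f t) ->
    (forall t, t0 < t -> derive1 f t <= - (c * f t)) ->
  f t @[t --> +oo] --> (0 : R).
Proof.
move=> c_gt0 df f_ge0 f'_le; pose g (r : R) := expR (c * r) * f r.
pose t1 := t0 + 1; have t01 : t0 < t1 by rewrite ltrDl.
have dg t : t0 < t ->
    is_derive t (1 : R) g (expR (c * t) * (derive1 f t + c * f t)).
  move=> t0t; rewrite derive1E.
  have dft := derivableP (df _ t0t).
  have dexp : is_derive t (1 : R) (fun r => expR (c * r)) (c * expR (c * t)).
    have dc : is_derive t (1 : R) ( *%R c) c.
      by apply: is_derive_eq; rewrite [LHS]mulr1.
    have := is_derive1_comp (is_derive_expR (c * t)) dc.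
    by rewrite mulrC; exact.
  have -> : expR (c * t) * ('D_1 f t + c * f t) =
      expR (c * t) *: 'D_1 f t + f t *: (c * expR (c * t)).
    by rewrite mulrDr mulrCA [_ *: (c * _)]mulrCA (mulrC (f t)).
  exact: is_deriveM dexp dft.
have g_decr t : t1 <= t -> g t <= g t1.
  move=> t1t; apply: (@ler0_derive1_le_cc _ g t1 t);
    rewrite ?in_itv /= ?lexx ?t1t //.
  - move=> r; rewrite in_itv /= => /andP[t1r _].
    by have [] := dg r (lt_trans t01 t1r).
  - move=> r; rewrite in_itv /= => /andP[t1r _].
    have t0r := lt_trans t01 t1r.
    rewrite derive1E; have [_ ->] := dg r t0r.
    rewrite pmulr_rle0 ?expR_gt0 // -lerBrDr sub0r; exact: f'_le.
  - apply: derivable_within_continuous => r; rewrite in_itv /= => /andP[t1r _].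
    by have [] := dg r (lt_le_trans t01 t1r).
have upper : g t1 * expR (- (t * c)) @[t --> +oo] --> (0 : R).
  rewrite -(mulr0 (g t1)); apply: cvgM; first exact: cvg_cst.
  apply: (cvg_comp (fun t : R => t * c) (fun s => expR (- s)) _ (@cvgr_expR R)).
  exact: gt0_cvgMly.
apply: (squeeze_cvgr _ (cvg_cst 0) upper); near=> t.
have t1t : t1 <= t by near: t; apply: nbhs_pinfty_ge; exact: num_real.
rewrite f_ge0 ?(lt_le_trans t01) //= expRN ler_pdivlMr ?expR_gt0 //.
by rewrite mulrC (mulrC t); exact: g_decr.
Unshelve. all: by end_near. Qed.

Lemma cvg0_enorm a (w : R -> 'cV[R]_a) (f : R -> R) (t0 : R) :
    (forall t, t0 < t -> enorm (w t) ^+ 2 <= f t) ->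
    f t @[t --> +oo] --> (0 : R) ->
  w t @[t --> +oo] --> (0 : 'cV[R]_a).
Proof.
move=> wf f0; apply/cvgr0Pnorm_lt => e e_gt0.
have fe : \forall t \near +oo, `|f t| < e ^+ 2.
  by apply: cvgr0_norm_lt; rewrite ?exprn_gt0.
near=> t.
rewrite [ltLHS]/Num.Def.normr /= mx_normrE; apply: bigmax_lt => //= -[i o] _ /=.
rewrite (ord1 o) -(@ltr_pXn2r _ 2) ?nnegrE ?normr_ge0 ?ltW //.
rewrite real_normK ?num_real //.
apply: le_lt_trans (sqr_coord_le _ _) _.
have tt0 : t0 < t by near: t; apply: nbhs_pinfty_gt; exact: num_real.
apply: le_lt_trans (wf t tt0) _; apply: le_lt_trans (ler_norm _) _.
by near: t.
Unshelve. all: by end_near. Qed.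

(** A curve in a subspace has its derivative in that subspace: applied to
    [M *m xi] and the image by [M] of each member of the Wong sequence, this
    puts [N *m xi] into that image, which is membership in the next one.  The
    subspace is described by a matrix [K] vanishing on it, and [xi] need not be
    differentiable itself. *)
Lemma wongV_trajectory a b (M N : 'M[R]_(a, b)) (xi : R -> 'cV[R]_b) (t0 : R) :
    (forall t : R, t0 < t ->
      is_derive t (1 : R) (fun r => M *m xi r) (N *m xi t)) ->
  forall t, t0 < t -> wongV M N (xi t).
Proof.
move=> Mxi t + i _; elim: i t => [|i IHi] t t0t //.
apply/wongV_seqE; rewrite /= sub_kermx mulmxA -submxE.
pose K := (cokermx (wong_mx M N i *m M^T))^T.
have Mxi_in r : t0 < r -> K *m (M *m xi r) = 0.
  move=> /IHi/wongV_seqE xr; apply: trmx_inj; rewrite !trmx_mul trmx0 trmxK.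
  by apply/eqP; rewrite -submxE submxMr.
have KM0 : \forall r \near t, (cst 0 : R -> 'cV[R]_a) r = K *m (M *m xi r).
  near=> r; rewrite Mxi_in //; near: r; apply: open_nbhs_nbhs.
  by split=> //; exact: open_gt.
have [dM M'] := Mxi t t0t.
have [_] := is_derive_mulmxl K dM.
rewrite derive1E M' -(near_eq_derive _ KM0) derive_cst => KN.
by rewrite submxE -trmx_mul -[X in _ *m X]trmxK -trmx_mul -/K -KN trmx0.
Unshelve. all: by end_near. Qed.

End Asymptotics.

Section Stability.
Context (R : realType).

(** Lyapunov stability of a linear descriptor system with a free input [phi]:
    everything is read in coordinates [v] of a basis [X] of the Wong limit,
    where [S] is the matrix of the Lyapunov function and invariance turns its
    derivative into a bilinear expression in [v] and [Y *m v]. *)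
Lemma dae_stability a b q (E A : 'M[R]_(a, b)) (B : 'M[R]_(a, q))
    (P : 'M[R]_(a, b)) (Q : 'M[R]_(b + q))
    (w : R -> 'cV[R]_b) (phi : R -> 'cV[R]_q) (t0 : R) :
  let VV := wongV (row_mx E 0) (row_mx A B) in
  let VVbar := [set (row_mx 1%:M 0 : 'M[R]_(b, b + q)) *m x | x in VV] in
  E^T *m P = P^T *m E -> nonneg_on VVbar (E^T *m P) -> neg_on VV Q ->
  (forall t, t0 < t -> derivable w t 1 /\
     E *m derive1 w t = A *m w t + B *m phi t) ->
  (forall t, t0 < t ->
     2 * ((w t)^T *m P^T *m (A *m w t + B *m phi t)) 0 0 <=
       qform Q (col_mx (w t) (phi t))) ->
  enorm (w t) ^+ 2 @[t --> +oo] --> (0 : R).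
Proof.
move=> VV VVbar EP EP_ge0 Q_neg dw dissip.
have [d [X [Y [[rkX defVV] ABX]]]] := wongV_basis (row_mx E 0) (row_mx A B).
pose pi := row_mx 1%:M 0 : 'M[R]_(b, b + q).
have VVX v : VV (X *m v) by rewrite /VV -defVV; exists v.
have X_inj v : v != 0 -> X *m v != 0.
  have /row_freeP[X' XX'] : row_free X^T by rewrite /row_free mxrank_tr rkX.
  apply: contra => /eqP Xv0; rewrite -[v]mul1mx -trmx1 -XX' trmx_mul trmxK.
  by rewrite -mulmxA Xv0 mulmx0.
pose S := (pi *m X)^T *m (E^T *m P) *m (pi *m X).
have SE v : qform S v = qform (E^T *m P) (pi *m (X *m v)).
  by rewrite mulmxA [RHS]qform_mul.
have ST : S^T = S by rewrite /S !trmx_mul !trmxK EP !mulmxA.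
have S_ge0 v : 0 <= qform S v by rewrite SE; apply: EP_ge0; exists (X *m v).
have N_neg v : v != 0 -> qform (X^T *m Q *m X) v < 0.
  by move=> /X_inj Xv0; rewrite -qform_mul; exact: Q_neg.
have [K [c [K_gt0 c_gt0 cmp]]] := lyapunov_comparison Y ST S_ge0 N_neg.
have in_VV t : t0 < t -> VV (col_mx (w t) (phi t)).
  pose xi r := col_mx (w r) (phi r).
  move=> t0t; apply: (wongV_trajectory (xi := xi) (t0 := t0)) => // r t0r.
  have [dwr Ewr] := dw r t0r.
  under eq_fun do rewrite mul_row_col mul0mx addr0.
  by rewrite mul_row_col -Ewr; exact: is_derive_mulmxl.
pose f r := qform (E^T *m P) (w r).
have df t : t0 < t -> is_derive t (1 : R) f
    (2 * ((w t)^T *m P^T *m (A *m w t + B *m phi t)) 0 0).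
  move=> t0t; have [dwt <-] := dw t t0t; rewrite mulmxA -(mulmxA _ P^T) -EP.
  by apply: is_derive_qform => //; rewrite trmx_mul trmxK EP.
have decay t : t0 < t -> exists v, [/\ w t = pi *m X *m v,
    enorm v ^+ 2 <= K * f t & derive1 f t <= - (c * f t)].
  move=> t0t; have := in_VV t t0t; rewrite /VV -defVV => -[v _ Xv].
  have wE : w t = pi *m X *m v.
    by rewrite -mulmxA Xv /pi mul_row_col mul1mx mul0mx addr0.
  have fE : qform S v = f t by rewrite SE mulmxA -wE.
  have EpiE : row_mx E 0 = E *m pi by rewrite /pi mul_mx_row mulmx1 mulmx0.
  have rateE : v^T *m S *m (Y *m v) =
      (w t)^T *m P^T *m (A *m w t + B *m phi t).
    rewrite -mul_row_col -Xv [row_mx A B *m _]mulmxA ABX EpiE /S EP wE.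
    by rewrite !trmx_mul !mulmxA.
  have [_ f'E] := df t t0t; have [|vf f'f] := cmp v.
    by rewrite rateE -qform_mul Xv; exact: dissip.
  exists v; split=> //; first by rewrite -fE.
  by rewrite derive1E f'E -rateE -fE.
have [C C_gt0 wC] := qform_le ((pi *m X)^T *m (pi *m X)).
have f_ge0 t : t0 < t -> 0 <= f t.
  by move=> /decay[v [wE _ _]]; rewrite /f wE -mulmxA -SE.
have f0 : f t @[t --> +oo] --> (0 : R).
  apply: (exponential_decay c_gt0 _ f_ge0) => t t0t; first by case: (df t t0t).
  by have [v []] := decay t t0t.
have upper : C * K * f t @[t --> +oo] --> (0 : R).
  by rewrite -(mulr0 (C * K)); apply: cvgM => //; exact: cvg_cst.
apply: (squeeze_cvgr _ (cvg_cst 0) upper); near=> t.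
have [|v [wE vK _]] := decay t.
  by near: t; apply: nbhs_pinfty_gt; exact: num_real.
by rewrite sqr_ge0 /= wE -qform_gram (le_trans (wC v)) // -mulrA ler_pM2l.
Unshelve. all: by end_near. Qed.

End Stability.

(** * The error dynamics of the observer *)

Section ErrorDynamics.
Context (R : realType) (l n m p qL qM k : nat) (s : da_system R l n m p qL qM).
Variables (L1 : 'M[R]_(l, k)) (L2 : 'M[R]_(p, k)).

(** The observer is the system itself, corrected by terms in [d]; it accepts
    every trajectory of the system with [d = 0]. *)
Lemma observer_acceptor : acceptor s L1 L2.
Proof.
move=> I x u y openI [C1x cuy inXUY eqs]; exists x, (fun=> 0); split=> //.
  split=> //; split=> [t It|]; first exact: derivable_cst.
  have -> : derive1 (fun=> 0 : 'cV[R]_k) = fun=> 0.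
    by apply/funext => t; rewrite derive1_cst.
  exact/continuous_subspaceT/cst_continuous.
move=> t It; have [-> ->] := eqs t It; rewrite !mulmx0 !addr0; split.
  by rewrite /sB /sf mul_row_col addrA.
by rewrite opprD addrA subrr add0r addNr.
Qed.

(** The difference of the equations of observer and system; their two solutions
    come with their own inputs and outputs, which need to agree at the time [t]
    only. *)
Lemma error_equation I I' x z d u y u' y' (t : R) :
    sigma_sol s I x u y -> omega_sol s L1 L2 I' z d u' y' ->
    I t -> I' t -> u' t = u t -> y' t = y t ->
  let w := fun r => col_mx (z r - x r) (d r) in
  derivable w t 1 /\
  calE s k *m derive1 w t =
    calA s L1 L2 *m w t +
      calB s *m (sf s (z t) (u t) (y t) - sf s (x t) (u t) (y t)).
Proof.
move=> [[dx _] _ _ eqx] [[[dz _] [dd _]] _ _ eqz] It I't ut yt w.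
have dxt := dx t It; have dzt := dz t I't; have ddt := dd t I't.
have dzx : is_derive t (1 : R) (fun r => z r - x r) (derive1 z t - derive1 x t).
  rewrite !derive1E.
  exact: is_deriveB (derivableP dzt) (derivableP dxt).
have [dzx' zx'] := dzx.
have [dw w'] := is_derive_col_mx dzx' ddt.
split=> //.
have [Ex yx] := eqx t It; have [Ez yz] := eqz t I't.
have [_ Ex'] := is_derive_mulmxl (sE s) dxt; rewrite derive1E Ex' in Ex.
have [_ Ez'] := is_derive_mulmxl (sE s) dzt; rewrite derive1E Ez' ut yt in Ez.
rewrite ut yt in yz.
rewrite derive1E w' derive1E zx' /calE mul_block_col !mul0mx !addr0.
rewrite mulmxBr Ez Ex -[sA s *m x t + _ + _]addrA.
rewrite /calA mul_block_col /calB mul_col_mx mul0mx add_col_mx addr0.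
congr col_mx; last first.
  rewrite [LHS]yz yx mulmxBr opprD addrA.
  by rewrite -(addrA _ (- sh s (u t))) addNr addr0.
rewrite !mulmxBr -/(sB s).
have <- : sB s *m sf s (x t) (u t) (y t) =
    sBL s *m sfL s (x t) (u t) (y t) + sBM s *m sfM s (sJ s *m x t) (u t) (y t).
  by rewrite mul_row_col.
rewrite opprD (addrAC (sA s *m z t)) addrACA.
by rewrite (addrAC (sA s *m z t) (L1 *m d t)).
Qed.

(** The two sides differ by [delta] times the slack of the Lipschitz condition,
    squared on both sides, plus twice the slack of the monotonicity condition:
    the terms of the block matrix with [delta], [mu] and [Theta] are there to
    produce exactly these. *)
Lemma dissipation_inequality (j : nat) (F : 'M[R]_(j, n)) (Theta : 'M[R]_qM)
    (mu delta : R) (P : 'M[R]_(l + p, n + k)) (K : 'M[R]_(n + k))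
    (e : 'cV[R]_n) (d : 'cV[R]_k) (phiL : 'cV[R]_qL) (phiM : 'cV[R]_qM) :
    0 < delta -> P^T *m calA s L1 L2 = P^T *m hatA s k + K *m matH R n k ->
    enorm phiL <= enorm (F *m e) ->
    2^-1 * mu * enorm (sJ s *m e) ^+ 2 <=
      ((sJ s *m e)^T *m Theta *m phiM) 0 0 ->
  2 * ((col_mx e d)^T *m P^T *m
       (calA s L1 L2 *m col_mx e d + calB s *m col_mx phiL phiM)) 0 0 <=
  qform (block_mx
    ((hatA s k)^T *m P + P^T *m hatA s k + (matH R n k)^T *m K^T
       + K *m matH R n k + delta *: ((calF k F)^T *m calF k F) - mu *: calJ s k)
    (P^T *m calB s + hatTheta s k Theta)
    ((calB s)^T *m P + (hatTheta s k Theta)^T)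
    (- (delta *: Lambda R qL qM)))
    (col_mx (col_mx e d) (col_mx phiL phiM)).
Proof.
move=> delta_gt0 PA Lip Mon.
set w := col_mx e d; set phi := col_mx phiL phiM.
pose T := P^T *m calA s L1 L2.
have -> : (hatA s k)^T *m P + P^T *m hatA s k + (matH R n k)^T *m K^T
    + K *m matH R n k = T^T + T.
  rewrite /T PA linearD /= !trmx_mul trmxK !addrA; congr (_ + _).
  by rewrite addrAC.
have -> : (calB s)^T *m P + (hatTheta s k Theta)^T =
    (P^T *m calB s + hatTheta s k Theta)^T.
  by rewrite linearD /= trmx_mul trmxK.
have addE (a b : 'M[R]_1) : (a + b) 0 0 = a 0 0 + b 0 0 by rewrite mxE.
rewrite qform_block !mulmxDr mulmxDl !addE.
rewrite -!scaleNr !qformD qform_tr !qform_scale.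
have FE : qform ((calF k F)^T *m calF k F) w = enorm (F *m e) ^+ 2.
  by rewrite qform_gram /calF mul_row_col mul0mx addr0.
have JE : qform (calJ s k) w = enorm (sJ s *m e) ^+ 2.
  rewrite -qform_gram /qform /calJ tr_col_mx mul_row_block !mulmx0 !addr0.
  by rewrite mul_row_col mul0mx addr0.
have LE : qform (Lambda R qL qM) phi = enorm phiL ^+ 2.
  rewrite enorm_sqr /qform /Lambda tr_col_mx mul_row_block !mulmx0 !addr0.
  by rewrite mulmx1 mul_row_col mul0mx addr0.
have TE : (w^T *m hatTheta s k Theta *m phi) 0 0 =
    ((sJ s *m e)^T *m Theta *m phiM) 0 0.
  rewrite /hatTheta tr_col_mx mul_row_block !mulmx0 !addr0.
  by rewrite mul_row_col mul0mx add0r trmx_mul !mulmxA.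
rewrite FE JE LE TE.
have wTw : (w^T *m P^T *m (calA s L1 L2 *m w)) 0 0 = qform T w.
  by rewrite /qform /T !mulmxA.
have wBphi : (w^T *m (P^T *m calB s) *m phi) 0 0 =
    (w^T *m P^T *m (calB s *m phi)) 0 0 by rewrite !mulmxA.
rewrite wTw wBphi.
have Lip2 : enorm phiL ^+ 2 <= enorm (F *m e) ^+ 2.
  by rewrite ler_pXn2r ?nnegrE ?sqrtr_ge0.
have := ler_wpM2l (ltW delta_gt0) Lip2.
move: Mon; lra.
Qed.

End ErrorDynamics.

Unset Implicit Arguments.
Set Strict Implicit.

(** * The state estimator *)

Theorem theorem4p3 (R : realType) (l n m p qL qM j k dV dW : nat)
  (s : da_system R l n m p qL qM)
  (F : 'M[R]_(j, n)) (Theta : 'M[R]_qM) (mu : R)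
  (hLip : lipschitz_cond s F)
  (hMon : monotone_cond s Theta mu)
  (hn : (n <= l + p)%N) (hk : k = (l + p - n)%N)
  (delta : R) (hdelta : 0 < delta)
  (P : 'M[R]_(l + p, n + k)) (hP : invertible P)
  (K : 'M[R]_(n + k))
  (L1 : 'M[R]_(l, k)) (L2 : 'M[R]_(p, k))
  (hL : block_mx 0 L1 0 L2 = (pinvmx P)^T *m K *m matH R n k)
  (V : 'M[R]_(n + k, dV)) (W : 'M[R]_(n + k, dW))
  (hV : basis_matrix (wongV (calE s k) (calA s L1 L2)) V)
  (hW : basis_matrix (wongW (calE s k) (calA s L1 L2)) W) :
  let cE := calE s k in
  let cA := calA s L1 L2 in
  let cB := calB s in
  let H := matH R n k in
  let cF := calF k F in
  let VV := wongV (row_mx cE (0 : 'M[R]_(l + p, qL + qM))) (row_mx cA cB) in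
  let VVbar := [set (row_mx 1%:M 0 : 'M[R]_(n + k, n + k + (qL + qM))) *m w
               | w in VV] in
  let Q := block_mx
    ((hatA s k)^T *m P + P^T *m hatA s k + H^T *m K^T + K *m H
       + delta *: (cF^T *m cF) - mu *: calJ s k)
    (P^T *m cB + hatTheta s k Theta)
    (cB^T *m P + (hatTheta s k Theta)^T)
    (- (delta *: Lambda R qL qM)) in
  let GL := gain cE cA V W (sBL s) in
  let GM := gain cE cA V W (sBM s) in
  let J := sJ s in
  let tTheta := Theta *m invmx (J *m GM) in
  let Gamma := tTheta + tTheta^T in
  let Gmu := invmx (Gamma - mu%:M) in
  let S := tTheta^T *m Gmu *m tTheta in
  forall
  (hQ : neg_on VV Q)
  (ha : cE^T *m P = P^T *m cE /\ nonneg_on VVbar (cE^T *m P))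
  (hb : regular_pencil cE cA /\
        exists nu : nat, is_index cE cA nu /\ (nu <= 1)%N)
  (hc : (0 < qL)%N -> opnorm (F *m GL) < 1)
  (hd : (0 < qM)%N -> J *m GM \in unitmx /\ lambda_max Gamma < mu)
  (he : (0 < qL)%N -> (0 < qM)%N ->
    exists alpha : R,
      [/\ 0 < alpha,
          forall x : 'cV[R]_n, enorm (F *m x) <= alpha * enorm (J *m x)
        & alpha * opnorm (J *m GL) / (1 - opnorm (F *m GL)) *
            (Num.sqrt (Num.max 0 (lambda_max S) / (mu - lambda_max Gamma))
             + opnorm (Gmu *m (tTheta^T - mu%:M))) < 1]),
  state_estimator s L1 L2.
Proof.
move=> cE cA cB H cF VV VVbar Q GL GM J tTheta Gamma Gmu S.
move=> hQ [EP EP_ge0] _ _ _ _.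
split; first exact: observer_acceptor.
move=> t0 x z d u y [I1 [x' [u1 [y1 [_ t0I1 sol_x eqx]]]]].
move=> [I2 [z' [d' [u2 [y2 [_ t0I2 sol_z eqz]]]]]].
have in_I1 t : t0 < t -> I1 t.
  by move=> /ltW t0t; apply: t0I1; rewrite /= in_itv /= t0t.
have in_I2 t : t0 < t -> I2 t.
  by move=> /ltW t0t; apply: t0I2; rewrite /= in_itv /= t0t.
pose w t := col_mx (z' t - x' t) (d' t).
pose phi t := sf s (z' t) (u1 t) (y1 t) - sf s (x' t) (u1 t) (y1 t).
have u12 t : t0 < t -> u2 t = u1 t.
  by move=> /ltW t0t; have [_ <- _] := eqx t t0t; have [_ _ <- _] := eqz t t0t.
have y12 t : t0 < t -> y2 t = y1 t.
  by move=> /ltW t0t; have [_ _ <-] := eqx t t0t; have [_ _ _ <-] := eqz t t0t.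
have PA : P^T *m cA = P^T *m hatA s k + K *m H.
  have -> : cA = hatA s k + block_mx 0 L1 0 L2.
    by rewrite /cA /calA /hatA add_block_mx !addr0 !add0r.
  rewrite mulmxDr hL !mulmxA -trmx_mul.
  by have [_ ->] := pinvmx_inverse hP; rewrite trmx1 mul1mx.
have w0 : enorm (w t) ^+ 2 @[t --> +oo] --> (0 : R).
  apply: (dae_stability (phi := phi) EP EP_ge0 hQ (t0 := t0)) => t t0t.
    exact: error_equation sol_x sol_z (in_I1 t t0t) (in_I2 t t0t) (u12 t t0t)
      (y12 t t0t).
  have [_ _ /(_ t (in_I1 t t0t)) [Xx Uu Yy] _] := sol_x.
  have [_ _ /(_ t (in_I2 t t0t)) [Xz _ _] _] := sol_z.
  rewrite /phi /sf opp_col_mx add_col_mx.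
  apply: dissipation_inequality => //; first exact: hLip.
  by rewrite mulmxBr; apply: hMon => //; [exists (x' t) | exists (z' t)].
apply: (cvg0_enorm (t0 := t0) _ w0) => t t0t.
have [-> _ _] := eqx t (ltW t0t); have [-> _ _ _] := eqz t (ltW t0t).
by rewrite [leRHS]enorm_sqr tr_col_mx mul_row_col mxE -!enorm_sqr lerDl sqr_ge0.
Qed.
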